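(* For all integers $m\ge 2$ and $n\ge 2$ there exists a proportional mechanism $(A,p)$ for the job scheduling problem over the set $\mathcal{C}$ of general instances with $m$ machines and $n$ jobs such that $A$ gives a $3/2$-approximation to the optimal makespan, i.e. $\max_{i\in[m]} c_i(A(c)_i)\le \tfrac32\,\mathrm{OPT}(c)$ for every $c\in\mathcal{C}$.
   Context: Notation: $[k]=\{1,\dots,k\}$. There are $m$ machines $[m]$ and $n$ jobs $[n]$. An instance is a matrix $c\in\mathbb{R}_{\ge0}^{m\times n}$, where $c_{i,j}$ is the cost (processing time) of job $j$ on machine $i$; for $S\subseteq[n]$, $c_i(S)=\sum_{j\in S}c_{i,j}$. The set of general instances is $\mathcal{C}=\mathbb{R}_{\ge0}^{m\times n}$. An allocation is a tuple $(X_1,\dots,X_m)$ of pairwise disjoint subsets of $[n]$ whose union is $[n]$. A mechanism $(A,p)$ over a set of instances $\mathcal{I}$ assigns to each $c\in\mathcal{I}$ an allocation $A(c)=(A(c)_1,\dots,A(c)_m)$ and payments $p(c)=(p(c)_1,\dots,p(c)_m)\in\mathbb{R}^m$ (written $A_i,p_i$ when $c$ is clear). The mechanism is proportional if for every $c\in\mathcal{I}$ and every $i\in[m]$: $c_i(A_i)-p_i\le \frac1m\sum_{j\in[m]}\big(c_i(A_j)-p_j\big)$. $\mathrm{OPT}(c)=\min_X\max_{i\in[m]}c_i(X_i)$ over all allocations $X$. An allocation function $A$ over $\mathcal{I}$ gives a $\beta$-approximation to the optimal makespan ($\beta\ge1$) if $\max_{i\in[m]}c_i(A(c)_i)\le\beta\,\mathrm{OPT}(c)$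 for all $c\in\mathcal{I}$. *)

(* Defs.v *)
From mathcomp Require Import all_boot all_order all_algebra.
From mathcomp Require Import reals.
Set Implicit Arguments. Unset Strict Implicit. Unset Printing Implicit Defensive.
Import Order.TTheory GRing.Theory Num.Theory.
Local Open Scope ring_scope.

(* An instance: c i j = cost of job j on machine i. *)
Definition instance (R : realFieldType) (m n : nat) := 'M[R]_(m, n).

Definition general_instance (R : realFieldType) (m n : nat) (c : 'M[R]_(m, n)) : Prop :=
  forall i j, 0 <= c i j.

(* An allocation (X_1,...,X_m), a partition of the jobs, is represented by the
   map sending each job to the machine it is allocated to. *)
Definition allocation (m n : nat) := {ffun 'I_n -> 'I_m}.

Definition bundle (m n : nat) (X : allocation m n) (i : 'I_m) : {set 'I_n} :=
  [set j | X j == i].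

Definition cost (R : realFieldType) (m n : nat) (c : 'M[R]_(m, n)) (i : 'I_m)
  (S : {set 'I_n}) : R := \sum_(j in S) c i j.

Definition makespan (R : realFieldType) (m n : nat) (c : 'M[R]_(m, n))
  (X : allocation m n) : R :=
  \big[Num.max/0]_(i < m) cost c i (bundle X i).

(* OPT(c) = min over all allocations of the makespan (for nonnegative costs
   makespans are >= 0 and there is at least one allocation when m >= 1;
   we take the min of the finite nonempty family, seeded with an arbitrary
   allocation value via a fold over the enumeration). *)
Definition OPT (R : realFieldType) (m n : nat) (c : 'M[R]_(m, n)) : R :=
  match enum (allocation m n) with
  | [::] => 0
  | X0 :: _ => \big[Num.min/makespan c X0]_(X : allocation m n) makespan c X
  end.

Definition proportional (R : realFieldType) (m n : nat)
  (A : 'M[R]_(m, n) -> allocation m n) (p : 'M[R]_(m, n) -> 'rV[R]_m) : Prop :=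
  forall c, general_instance c ->
  forall i : 'I_m,
    cost c i (bundle (A c) i) - p c 0 i <=
    m%:R^-1 * \sum_(k < m) (cost c i (bundle (A c) k) - p c 0 k).

Definition approx (R : realFieldType) (m n : nat) (beta : R)
  (A : 'M[R]_(m, n) -> allocation m n) : Prop :=
  forall c, general_instance c -> makespan c (A c) <= beta * OPT c.

(* Main.v *)
(** Proportionality is attainable by payments exactly when the total cost
    [\sum_i c_i(A_i)] is at most the average [(1/m) \sum_i c_i([n])].  Start from
    an optimal allocation [X] and put [d i k = c_i(X_k)], so [d k k <= OPT].  The
    involutions [k |-> s - k] of Z/m cover every pair (machine, bundle) exactly
    once as [s] varies, so for some [s] handing bundle [k] to machine [s - k]
    costs at most the average.  If a swap inside a pair [{i, k}] overloads
    machine [i], i.e. [d i k > 3/2 OPT], then either [d k i > OPT / 2] and undoing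
    the swap is no more expensive, or [d k i <= OPT / 2] and machine [k] can take
    both bundles, again at no higher cost. *)
Require Import Defs.
From mathcomp Require Import all_boot all_order all_algebra.
From mathcomp Require Import reals lra.
Import Order.TTheory GRing.Theory Num.Theory.
Local Open Scope ring_scope.

Section Reassignment.
Variables (R : realFieldType) (I : finType) (d : I -> I -> R) (T : R) (tau : I -> I).
Hypotheses (d_ge0 : forall i k, 0 <= d i k) (d_own : forall i, d i i <= T).
Hypothesis tauK : involutive tau.

(** The first two tests are symmetric in [k] and [tau k], so both bundles of a pair take the same
    branch. In the last branch exactly one swapped cost exceeds [3 / 2 * T], and both bundles go to
    the same machine. *)
Definition reassign (k : I) : I :=
  let i := tau k in
  if (d i k <= 3 / 2 * T) && (d k i <= 3 / 2 * T) then i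
  else if d i i + d k k <= d i k + d k i then k
  else if 3 / 2 * T < d i k then k else i.

Lemma reassign_pair_cost (k : I) :
  d (reassign k) k + d (reassign (tau k)) (tau k) <= d (tau k) k + d k (tau k).
Proof.
rewrite /reassign tauK; set i := tau k.
have := d_own i; have := d_own k; have := d_ge0 i k; have := d_ge0 k i.
by case: (leP (d i k)); case: (leP (d k i));
  case: (leP (d i i + d k k)); case: (leP (d k k + d i i)) => /=; lra.
Qed.

(** The bound holds per pair, not per bundle: doubling both sums and reindexing along [tau] puts
    each bundle next to its partner, fixed points included. *)
Lemma reassign_cost : \sum_k d (reassign k) k <= \sum_k d (tau k) k.
Proof.
have dbl F : \sum_k F k + \sum_k F (tau k) = 2 * \sum_k F k :> R.
  by rewrite [X in X + _](reindex_inj (inv_inj tauK)) [RHS]mulrC mulr_natr mulr2n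
    [in RHS](reindex_inj (inv_inj tauK)).
rewrite -(ler_pM2l (ltr0n R 2)) -!dbl -!big_split /=.
by apply: ler_sum => k _; rewrite tauK; exact: reassign_pair_cost.
Qed.

Lemma reassignE (k : I) : (reassign k == k) || (reassign k == tau k).
Proof. by rewrite /reassign; do !case: ifP => _; rewrite eqxx ?orbT. Qed.

(** Machine [i] can only receive bundles [i] and [k = tau i]. If these differ and it gets both, then
    [d i k + d k i < d i i + d k k <= 2 * T] while [d k i > 3 / 2 * T], so [d i k < T / 2]. *)
Lemma reassign_load (i : I) :
  \sum_(k | reassign k == i) d i k <= 3 / 2 * T.
Proof.
have Ti := d_own i; have T0 : 0 <= T := le_trans (d_ge0 i i) Ti.
have out k : k != i -> k != tau i -> (reassign k == i) = false.
  move=> ki kt; apply/eqP => ri; have := reassignE k.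
  by rewrite ri eq_sym (negPf ki) /= => /eqP it; rewrite it tauK eqxx in kt.
rewrite big_mkcond (bigD1 i) //=.
have [ti|ti] := eqVneq (tau i) i.
  rewrite big1 => [|k ki]; last by rewrite out // ti.
  by rewrite addr0; case: ifP => _; lra.
rewrite (bigD1 (tau i)) //= big1 => [|k /andP[ki kt]]; last by rewrite out.
rewrite addr0 /reassign tauK; set k := tau i in ti *.
have := d_own k; have := d_ge0 i k; have := d_ge0 k i.
case: (leP (d i k)); case: (leP (d k i));
  case: (leP (d i i + d k k)); case: (leP (d k k + d i i)) => /=;
  rewrite ?eqxx ?(negPf ti) //; lra.
Qed.

End Reassignment.

Lemma exists_reassignment {R : realFieldType} {m : nat}
    (d : 'I_m.+1 -> 'I_m.+1 -> R) (T : R) :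
  (forall i k, 0 <= d i k) -> (forall i, d i i <= T) ->
  exists2 sigma : 'I_m.+1 -> 'I_m.+1,
    \sum_k d (sigma k) k <= m.+1%:R^-1 * \sum_i \sum_k d i k &
    forall i, \sum_(k | sigma k == i) d i k <= 3 / 2 * T.
Proof.
move=> d_ge0 d_own.
(* Subtraction in ['I_m.+1] is modular, so for fixed [k] the machine [s - k] runs over all machines
   once. *)
pose F s := \sum_k d (s - k) k.
have sumF : \sum_s F s = \sum_i \sum_k d i k.
  rewrite exchange_big [RHS]exchange_big /=; apply: eq_bigr => k _.
  by rewrite [RHS](reindex_inj (addIr (- k))).
have [s Fs] : exists s, F s <= m.+1%:R^-1 * \sum_i \sum_k d i k.
  apply/existsP; apply: contraT => /existsPn Fgt.
  suff: (m.+1%:R^-1 * \sum_i \sum_k d i k) *+ m.+1 < \sum_s F s.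
    by rewrite sumF -mulr_natl mulrA divff ?pnatr_eq0 // mul1r ltxx.
  rewrite -[X in _ *+ X](card_ord m.+1) -sumr_const.
  apply: ltr_sum => [|s _]; last by rewrite ltNge Fgt.
  by apply/hasP; exists 0; rewrite ?mem_index_enum.
have sK : involutive (fun k => s - k) by move=> k; rewrite subKr.
exists (@reassign _ _ d T (fun k => s - k)); last exact: reassign_load.
by apply: le_trans Fs; exact: reassign_cost.
Qed.

Lemma OPT_attained {R : realFieldType} {m n : nat} (c : 'M[R]_(m.+1, n)) :
  exists X : allocation m.+1 n, OPT c = makespan c X.
Proof.
rewrite /OPT; case E: (enum _) => [|X0 s].
  by have := mem_enum (allocation m.+1 n) [ffun=> ord0]; rewrite E.
(* The seed of the fold is itself a makespan, and [min] returns one of its arguments. *)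
apply: (big_ind (fun x => exists X, x = makespan c X)) => [|x y Hx Hy|X _].
- by exists X0.
- by rewrite /Num.min; case: ifP.
- by exists X.
Qed.

Lemma cost_merge {R : realFieldType} {m n : nat} (c : 'M[R]_(m, n))
    (X : allocation m n) (sigma : 'I_m -> 'I_m) (i l : 'I_m) :
  cost c i (bundle [ffun j => sigma (X j)] l) =
  \sum_(k | sigma k == l) cost c i (bundle X k).
Proof.
rewrite /cost (partition_big (fun j => X j) (fun k => sigma k == l)) /=.
  apply: eq_bigr => k /eqP kl; apply: eq_bigl => j.
  by rewrite !inE ffunE; case: (X j =P k) => [->|]; rewrite ?andbF // kl eqxx.
by move=> j; rewrite inE ffunE.
Qed.

Lemma sum_cost_bundle {R : realFieldType} {m n : nat} (c : 'M[R]_(m, n))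
    (X : allocation m n) (i : 'I_m) :
  \sum_k cost c i (bundle X k) = \sum_j c i j.
Proof.
rewrite [RHS](partition_big (fun j => X j) xpredT) //=.
by apply: eq_bigr => k _; apply: eq_bigl => j; rewrite inE.
Qed.

Lemma exists_cheap_allocation {R : realFieldType} {m n : nat} (c : 'M[R]_(m.+1, n)) :
  general_instance c ->
  exists Y : allocation m.+1 n,
    (makespan c Y <= 3 / 2 * OPT c) &&
    (\sum_i cost c i (bundle Y i) <= m.+1%:R^-1 * \sum_i \sum_j c i j).
Proof.
move=> c_ge0; have [X ->] := OPT_attained c.
pose d i k := cost c i (bundle X k).
have d_ge0 i k : 0 <= d i k by apply: sumr_ge0 => j _; exact: c_ge0.
have d_own i : d i i <= makespan c X.
  exact: (le_bigmax_cond _ (fun i => cost c i (bundle X i))).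
have [sigma le_avg le_load] := exists_reassignment _ _ d_ge0 d_own.
exists [ffun j => sigma (X j)]; apply/andP; split.
  (* [makespan] is a maximum seeded with 0, so the bound must also be shown nonnegative. *)
  apply/bigmax_leP; split=> [|i _]; last by rewrite cost_merge.
  by rewrite mulr_ge0 ?divr_ge0 ?ler0n // (le_trans (d_ge0 0 0)).
under eq_bigr => i _ do rewrite cost_merge.
under [in leRHS]eq_bigr => i _ do rewrite -(sum_cost_bundle c X).
apply: le_trans le_avg.
rewrite [leRHS](partition_big sigma xpredT) //=.
by apply: ler_sum => i _; apply: ler_sum => k /eqP ->.
Qed.

Theorem theorem1 (R : realType) (m n : nat) :
  (2 <= m)%N -> (2 <= n)%N ->
  exists (A : 'M[R]_(m, n) -> allocation m n) (p : 'M[R]_(m, n) -> 'rV[R]_m),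
    proportional A p /\ approx (3 / 2) A.
Proof.
case: m => // m _ _.
pose good (c : 'M[R]_(m.+1, n)) (Y : allocation m.+1 n) :=
  (makespan c Y <= 3 / 2 * OPT c) &&
  (\sum_i cost c i (bundle Y i) <= m.+1%:R^-1 * \sum_i \sum_j c i j).
(* The default only serves matrices with negative entries. *)
pose A c : allocation m.+1 n := odflt [ffun=> ord0] [pick Y | good c Y].
have goodA c : general_instance c -> good c (A c).
  move=> /exists_cheap_allocation [Y gY]; rewrite /A.
  by case: pickP => [//|/(_ Y)]; rewrite /good gY.
(* These payments leave machine [i] a net cost of exactly [1/m.+1] of its cost for all jobs;
   proportionality then says that the payments sum to at most 0, which is [le_avg]. *)
exists A, (fun c => \row_i (cost c i (bundle (A c) i) - m.+1%:R^-1 * \sum_j c i j)).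
split=> c /goodA /andP[] // _ le_avg i.
rewrite mxE subKr sumrB sum_cost_bundle ler_wpM2l ?invr_ge0 ?ler0n //.
under [X in _ - X]eq_bigr => k _ do rewrite mxE.
by rewrite sumrB -mulr_sumr lerDl oppr_ge0 subr_le0.
Qed.
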